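(* There exists a constant $A_1>0$, depending only on $d$, such that for all sufficiently small $r\in(0,1]$ (depending on $d$) and all $x\in\mathbb{R}^d$, $$\mu_r(x)\ \ge\ A_1\,\delta_d(r)\,\|x\|_1 .$$ In particular, $\lim_{r\searrow0}\mu_r(x)=\infty$ for every $x\in\mathbb{R}^d\setminus\{0\}$.
   Context: Frog model with Bernoulli initial configuration. Fix $d\ge2$ and $r\in(0,1]$. Let $\omega=(\omega(x))_{x\in\mathbb{Z}^d}$ be i.i.d. with $\mathbb{P}_r(\omega(x)=1)=1-\mathbb{P}_r(\omega(x)=0)=r$, and independently let $(S^x_k)_{k\ge0}$, $x\in\mathbb{Z}^d$, be independent simple random walks on $\mathbb{Z}^d$ with $S^x_0=x$; write $\mathbf P_r$ for the joint law. For $x,y\in\mathbb{Z}^d$ set $\tau(x,y):=\inf\{k\ge0:S^x_k=y\}$ if $\omega(x)=1$ and $\tau(x,y):=\infty$ if $\omega(x)=0$. The first passage time is $T(x,y):=\inf\{\sum_{i=0}^{m-1}\tau(x_i,x_{i+1}): m\in\mathbb{N},\ x_0,\dots,x_m\in\mathbb{Z}^d,\ x_0=x,\ x_m=y\}$. It is known that there is a deterministic norm $\mu_r$ on $\mathbb{R}^d$ (the time constant) such that $\mathbf P_r$-a.s. on $\{\omega(0)=1\}$, $\lim_{n\to\infty}T(0,nx)/n=\mu_r(x)$ for all $x\in\mathbb{Z}^d$. Define $\delta_d(r):=\sqrt{|\log r|/r}$ if $d=2$ and $\delta_d(r):=1/\sqrt r$ if $d\ge3$. $\|\cdot\|_1$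 is the $\ell^1$-norm. *)

(* Defs.v *)
From HB Require Import structures.
From mathcomp Require Import all_boot all_order all_algebra.
From mathcomp Require Import all_classical all_reals all_analysis.
Set Implicit Arguments. Unset Strict Implicit. Unset Printing Implicit Defensive.
Import Order.TTheory GRing.Theory Num.Theory.
Import numFieldNormedType.Exports.
Local Open Scope classical_set_scope.
Local Open Scope ring_scope.

Definition site (d : nat) := 'rV[int]_d.

Definition to_real (R : realType) d (x : site d) : 'rV[R]_d :=
  map_mx (fun z : int => z%:~R) x.

Definition l1norm (R : realType) d (x : 'rV[R]_d) : R := \sum_(i < d) `|x 0 i|.

Definition delta (R : realType) (d : nat) (r : R) : R :=
  if d == 2%N then Num.sqrt (`|ln r| / r) else (Num.sqrt r)^-1.

Definition nn_step d (u v : site d) : bool :=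
  (\sum_(i < d) absz (v ord0 i - u ord0 i))%N == 1%N.

Definition bern_weight (R : realType) (r : R) (b : bool) : R :=
  if b then r else 1 - r.

(* probability that a simple random walk started at x follows q on times 0..n *)
Definition path_weight (R : realType) d (x : site d) (n : nat) (q : nat -> site d) : R :=
  if (q 0%N == x) && [forall k : 'I_n, nn_step (q k) (q k.+1)]
  then ((2 * d)%:R ^- n) else 0.

Definition frog_cyl d (T : Type) (omega : site d -> T -> bool)
  (S : site d -> nat -> T -> site d) (xs : seq (site d)) (n : nat)
  (b : site d -> bool) (p : site d -> nat -> site d) : set T :=
  [set t | forall x, x \in xs ->
     omega x t = b x /\ forall k, (k <= n)%N -> S x k t = p x k].

(* (omega, S) under P: omega i.i.d. Bernoulli(r), S^x independent simple random
   walks started at x, independent of omega (all finite-dimensional laws). *)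
Definition frog_model (R : realType) d dsp (T : measurableType dsp)
  (P : probability T R) (r : R) (omega : site d -> T -> bool)
  (S : site d -> nat -> T -> site d) : Prop :=
  forall (xs : seq (site d)) (n : nat) (b : site d -> bool)
         (p : site d -> nat -> site d),
    uniq xs ->
    measurable (frog_cyl omega S xs n b p) /\
    P (frog_cyl omega S xs n b p)
      = (\prod_(x <- xs) (bern_weight r (b x) * path_weight R x n (p x)))%:E.

Definition hit_time (R : realType) d (T : Type) (omega : site d -> T -> bool)
  (S : site d -> nat -> T -> site d) (x y : site d) (t : T) : \bar R :=
  if omega x t then ereal_inf [set (k%:R)%:E | k in [set k : nat | S x k t = y]]
  else +oo%E.

Definition passage_time (R : realType) d (T : Type) (omega : site d -> T -> bool)
  (S : site d -> nat -> T -> site d) (x y : site d) (t : T) : \bar R :=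
  ereal_inf [set s | exists (m : nat) (xs : nat -> site d),
     xs 0%N = x /\ xs m = y /\
     s = (\sum_(i < m) hit_time R omega S (xs i) (xs i.+1) t)%E].

Definition is_norm (R : realType) d (mu : 'rV[R]_d -> R) : Prop :=
  (forall x, 0 <= mu x) /\ (forall x, mu x = 0 -> x = 0) /\
  (forall (a : R) x, mu (a *: x) = `|a| * mu x) /\
  (forall x y, mu (x + y) <= mu x + mu y).

Definition is_time_constant (R : realType) d (r : R) (mu : 'rV[R]_d -> R) : Prop :=
  is_norm mu /\
  exists (dsp : measure_display) (T : measurableType dsp) (P : probability T R)
         (omega : site d -> T -> bool) (S : site d -> nat -> T -> site d),
    frog_model P r omega S /\
    {ae P, forall t, omega 0%R t -> forall x : site d,
      (fun n : nat => ((n%:R)^-1)%:E * passage_time R omega S 0%R (x *+ n)%R t)%E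
        @ \oo --> (mu (to_real R x))%:E}.

(* Main.v *)
(**
The proof is a first moment estimate organised as a supermartingale. If
[T(0,y) <= K], then after loop erasure there are distinct sites
[0 = x_0, ..., x_m = y], occupied for [i < m], and first hitting times [k_i] of
[x_(i+1)] by the walk from [x_i], with [k_0 + ... + k_(m-1) <= K].  The walks
involved are distinct, hence independent, and revealing them one after the other
gives
  P(T(0,y) <= K) <= s^(-K) h(0)
for any [h >= 0] with [h(y) >= 1] and, for all [x],
  r * sum_z sum_k s^k P(S^x first hits z at time k) h(z) <= h(x).
Take [h(z) = a^(tilt(z - y))] with [tilt] linear, [tilt(y) = |y|_1],
[a = 1 + eta] and [s = 1/(1 + eta^2)].  By the renewal identity, the generating
function of the hitting times is the tilted Green function, which is at most
[4/eta^2], divided by the Green function at the origin, so the condition holds as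
soon as [4 r / eta^2 <= sum_j s^j P(S_j = 0)].  Bounding the right-hand side below
by [1] allows [eta] of order [sqrt r]; when [d = 2] it is of order
[log(1/eta)], which allows [eta^2] of order [r / |log r|].  The resulting
exponential decay yields [mu(x) >= |x|_1 / (4 eta)] for integer [x].
*)

Require Import Defs.
From HB Require Import structures.
From mathcomp Require Import all_boot all_order all_algebra.
From mathcomp Require Import all_classical all_reals all_analysis.
From mathcomp Require Import ring lra zify.
Set Implicit Arguments. Unset Strict Implicit. Unset Printing Implicit Defensive.
Import Order.TTheory GRing.Theory Num.Theory.
Import numFieldNormedType.Exports.
Local Open Scope classical_set_scope.
Local Open Scope ring_scope.

(** * Simple random walk *)

Definition unit_step d (w : 'I_d * bool) : site d :=
  if w.2 then delta_mx 0 w.1 else - delta_mx 0 w.1.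

Fixpoint walk_prob (R : realType) d n (z : site d) : R :=
  if n is n'.+1 then
    (2 * d)%:R^-1 * \sum_(w : 'I_d * bool) walk_prob R n' (z - unit_step w)
  else (z == 0)%:R.

(* The law of the first time a walk started at 0 visits [z], conditioning on its first step [w]. *)
Fixpoint hit_prob (R : realType) d n (z : site d) : R :=
  if n is n'.+1 then
    if z == 0 then 0
    else (2 * d)%:R^-1 * \sum_(w : 'I_d * bool) hit_prob R n' (z - unit_step w)
  else (z == 0)%:R.

(** One entry per sequence of [n] steps, so that counting entries and dividing by [(2d)^n] computes
    probabilities for the walk up to time [n]. *)
Fixpoint walks d n (x : site d) : seq (seq (site d)) :=
  if n is n'.+1 then
    [seq x :: q | w <- index_enum ('I_d * bool)%type, q <- walks n' (x + unit_step w)]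
  else [:: [:: x]].

Lemma walk_prob_ge0 (R : realType) d n (z : site d) : 0 <= walk_prob R n z.
Proof.
elim: n z => [|n IHn] z /=; first exact: ler0n.
by rewrite mulr_ge0 ?invr_ge0 ?ler0n// sumr_ge0.
Qed.

Lemma hit_prob_ge0 (R : realType) d n (z : site d) : 0 <= hit_prob R n z.
Proof.
elim: n z => [|n IHn] z /=; first exact: ler0n.
by case: ifP => // _; rewrite mulr_ge0 ?invr_ge0 ?ler0n// sumr_ge0.
Qed.

Lemma hit_prob0 (R : realType) d n : hit_prob R n (0 : site d) = (n == 0%N)%:R.
Proof. by case: n => [|n] /=; rewrite eqxx. Qed.

(* Decomposition at the first visit to [z]. *)
Lemma renewal (R : realType) d n (z : site d) :
  walk_prob R n z = \sum_(k < n.+1) hit_prob R k z * walk_prob R (n - k) (0 : site d).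
Proof.
elim: n z => [|n IHn] z; first by rewrite big_ord1 /= eqxx mulr1.
have [->|z0] := eqVneq z 0.
  rewrite big_ord_recl hit_prob0 mul1r subn0 big1 ?addr0// => i _.
  by rewrite hit_prob0 mul0r.
rewrite big_ord_recl /= (negPf z0) mul0r add0r.
under eq_bigr do rewrite IHn.
rewrite exchange_big mulr_sumr; apply: eq_bigr => k _.
by rewrite subSS -mulr_suml mulrA.
Qed.

Lemma card_unit_step d : #|{: 'I_d * bool}| = (2 * d)%N.
Proof. by rewrite card_prod card_ord card_bool mulnC. Qed.

Lemma count_walks d n (x : site d) (P : pred (seq (site d))) :
  count P (walks n.+1 x) =
  (\sum_(w : 'I_d * bool) count (fun q => P (x :: q)) (walks n (x + unit_step w)%R))%N.
Proof.
rewrite /= count_flatten sumnE !big_map; apply: eq_bigr => w _.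
by rewrite count_map.
Qed.

Lemma card_walks d n (x : site d) : size (walks n x) = ((2 * d) ^ n)%N.
Proof.
elim: n x => [|n IHn] x //; rewrite -count_predT count_walks.
rewrite (eq_bigr (fun=> (2 * d) ^ n)%N) => [|w _]; last first.
  by rewrite -(IHn (x + unit_step w)) -[RHS]count_predT.
by rewrite sum_nat_const card_unit_step expnS.
Qed.

(** Splitting off the first step matches the recursion of [hit_prob]; once [z] is hit, the remaining
    steps are free. The bound [k <= n] excludes the value [n + 1] that [index] returns when [z] is
    missed. *)
Lemma count_first_visit (R : realType) d n k (x z : site d) : (k <= n)%N ->
  (count (fun q => index z q == k) (walks n x))%:R =
    (2 * d)%:R ^+ n * hit_prob R k (z - x) :> R.
Proof.
elim: n k x => [|n IHn] k x.
  rewrite leqn0 => /eqP -> /=.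
  by rewrite mul1r subr_eq0 (eq_sym x z); case: (z == x).
case: k => [|k] kn.
  rewrite /hit_prob subr_eq0 eq_sym; have [->|xz] := eqVneq x z.
    rewrite mulr1 -natrX -(card_walks _ z) -count_predT; congr _%:R.
    by rewrite !count_walks; apply: eq_bigr => w _; apply: eq_count => q /=; rewrite eqxx.
  rewrite mulr0 count_walks big1// => w _.
  by rewrite (@eq_count _ _ pred0) ?count_pred0// => q /=; rewrite (negPf xz).
rewrite count_walks /hit_prob subr_eq0 eq_sym -/hit_prob; have [->|xz] := eqVneq x z.
  rewrite mulr0 big1// => w _.
  by rewrite (@eq_count _ _ pred0) ?count_pred0// => q /=; rewrite eqxx.
have [d0|d0] := posnP d.
  by rewrite !big1 ?mulr0// => -[[i i_lt]] *; exfalso; move: i_lt; rewrite d0.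
rewrite natr_sum exprS mulrCA !mulrA mulVf ?mul1r; last first.
  by rewrite pnatr_eq0 muln_eq0 negb_or /= -lt0n.
rewrite mulr_sumr; apply: eq_bigr => w _.
rewrite -addrA -opprD -IHn//; congr _%:R; apply: eq_count => q /=.
by rewrite (negPf xz).
Qed.

Lemma nn_stepP d (u v : site d) : nn_step u v -> exists w, v = u + unit_step w.
Proof.
move=> /eqP s1; have [i hi] : exists i : 'I_d, absz (v ord0 i - u ord0 i) != 0%N.
  apply/existsP; apply: contraT; rewrite negb_exists => /forallP h.
  by move: s1; rewrite big1// => i _; apply/eqP; have := h i; rewrite negbK.
have [h1 h0] : absz (v ord0 i - u ord0 i) = 1%N /\
    forall j, j != i -> v ord0 j = u ord0 j.
  move: s1; rewrite (bigD1 i)//=.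
  case: (absz _) hi => // -[|m] _ //; rewrite add1n => -[s0]; split=> // j ji.
  move/eqP: s0; rewrite sum_nat_eq0 => /forallP/(_ j); rewrite ji /= absz_eq0.
  by rewrite subr_eq0 => /eqP.
exists (i, (0 <= v ord0 i - u ord0 i)); apply/rowP => j.
rewrite /unit_step /= mxE; case: ifP => s; rewrite !mxE /= ?eqxx /= -[0]/(ord0 : 'I_1).
  have [->|/h0->] := eqVneq j i; last by rewrite addr0.
  by move: h1 s; move: (v ord0 i) (u ord0 i) => a b; lia.
have [->|/h0->] := eqVneq j i; last by rewrite subr0.
by move: h1 s; move: (v ord0 i) (u ord0 i) => a b; lia.
Qed.

Lemma mem_walks d n (p : nat -> site d) x : p 0%N = x ->
  (forall k, (k < n)%N -> nn_step (p k) (p k.+1)) -> mkseq p n.+1 \in walks n x.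
Proof.
elim: n p x => [|n IHn] p x p0 ps; first by rewrite /= inE /mkseq /= p0.
have /nn_stepP[w pw] := ps 0%N isT.
rewrite /mkseq /= p0; apply/allpairsPdep; exists w, (mkseq (p \o S) n.+1); split.
- exact: mem_index_enum.
- by apply: IHn => [|k kn] /=; [rewrite pw p0|apply: ps].
- by rewrite /mkseq /= (iotaDl 1 1) -map_comp.
Qed.

Lemma index_mkseq (T : eqType) (f : nat -> T) n k z : (k < n)%N -> f k = z ->
  (forall j, (j < k)%N -> f j <> z) -> index z (mkseq f n) = k.
Proof.
move=> kn fk fj; set q := mkseq f n.
have sq : size q = n by rewrite size_mkseq.
have zq : z \in q by rewrite -fk; apply: map_f; rewrite mem_iota.
have iq : (index z q < n)%N by rewrite -sq index_mem.
apply/eqP; rewrite eqn_leq; apply/andP; split; rewrite leqNgt; apply/negP => h.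
  by have := @before_find _ z (pred1 z) q k h; rewrite /= nth_mkseq// fk eqxx.
by apply: (fj _ h); rewrite -(nth_mkseq z f iq) nth_index.
Qed.

(** * Revealing the walks one by one *)

(* Avoids proving that the events built from first visits and paths are measurable. *)
Definition outer_le (R : realType) dsp (T : measurableType dsp) (P : probability T R)
  (E : set T) (c : R) : Prop :=
  exists M : set T, [/\ measurable M, E `<=` M & (P M <= c%:E)%E].

Lemma outer_le_sub (R : realType) dsp (T : measurableType dsp) (P : probability T R)
  (E F : set T) (c c' : R) :
  E `<=` F -> c <= c' -> outer_le P F c -> outer_le P E c'.
Proof.
move=> EF cc' [M [mM FM PM]]; exists M; split => //; first exact: subset_trans FM.
by rewrite (le_trans PM)// lee_fin.
Qed.

Lemma outer_le_set0 (R : realType) dsp (T : measurableType dsp) (P : probability T R)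
  (c : R) : 0 <= c -> outer_le P set0 c.
Proof. by move=> c0; exists set0; split => //; rewrite measure0 lee_fin. Qed.

Lemma outer_le_bigU (R : realType) dsp (T : measurableType dsp) (P : probability T R)
  (I : eqType) (s : seq I) (E : I -> set T) (c : I -> R) :
  (forall i, i \in s -> outer_le P (E i) (c i)) ->
  outer_le P [set t | exists2 i, i \in s & E i t] (\sum_(i <- s) c i).
Proof.
elim: s => [|i s IHs] h.
  by rewrite big_nil; apply: outer_le_sub (outer_le_set0 P (lexx 0)) => // t [].
have [M [mM sM PM]] := h i (mem_head _ _).
have [N [mN sN PN]] : outer_le P [set t | exists2 i, i \in s & E i t] (\sum_(i <- s) c i).
  by apply: IHs => j js; apply: h; rewrite inE js orbT.
exists (M `|` N); split; first exact: measurableU.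
- move=> t [j]; rewrite inE => /orP[/eqP -> /sM|js Ej]; first by left.
  by right; apply: sN; exists j.
- by rewrite big_cons EFinD (le_trans (measureU2 _ _ _))// leeD.
Qed.

(** Intersecting measurable covers of measure at most [1/(k+1)] gives a null cover. *)
Lemma outer_le_negligible (R : realType) dsp (T : measurableType dsp)
  (P : probability T R) (E : set T) :
  (forall e : R, 0 < e -> outer_le P E e) -> P.-negligible E.
Proof.
move=> h.
have /choice[M hM] : forall k : nat, exists M : set T,
    [/\ measurable M, E `<=` M & (P M <= (k.+1%:R^-1)%:E)%E].
  by move=> k; apply: h; rewrite invr_gt0.
have mI : measurable (\bigcap_k M k) by apply: bigcap_measurableType => k _; case: (hM k).
exists (\bigcap_k M k); split => //; last first.
  by move=> t Et k _; have [_ + _] := hM k; apply.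
apply/eqP; rewrite -measure_le0; apply/lee_addgt0Pr => e e0; rewrite add0e.
have [k ke] : exists k : nat, k.+1%:R^-1 < e.
  have [k _ ke] := near_infty_natSinv_lt (PosNum e0).
  by exists k; exact: (ke k (leqnn k)).
have [mMk _ PMk] := hM k.
rewrite (le_trans _ (le_trans PMk _))//; last by rewrite lee_fin ltW.
by rewrite le_measure ?inE//; apply: bigcap_inf.
Qed.

Lemma path_weight_ge0 (R : realType) d (x : site d) n q : 0 <= path_weight R x n q.
Proof. by rewrite /path_weight; case: ifP => // _; rewrite invr_ge0 exprn_ge0. Qed.

Lemma path_weight_le (R : realType) d (x : site d) n q :
  path_weight R x n q <= (2 * d)%:R ^- n.
Proof. by rewrite /path_weight; case: ifP => // _; rewrite invr_ge0 exprn_ge0. Qed.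

Definition walk_good d (T : Type) (S : site d -> nat -> T -> site d) : set T :=
  [set t | forall x n, mkseq (fun k => S x k t) n.+1 \in walks n x].

(** The bad event lies in a countable union, indexed through [unpickle], of cylinders prescribing to
    one walk a trajectory outside [walks n x]; such trajectories have weight zero. The Boolean [c]
    stands for the value of [omega x], which a cylinder also prescribes. *)
Lemma walk_good_ae (R : realType) d dsp (T : measurableType dsp)
  (P : probability T R) (r : R) omega (S : site d -> nat -> T -> site d) :
  frog_model P r omega S -> P.-negligible (~` walk_good S).
Proof.
move=> fm.
pose F k : set T := if unpickle k is Some (x, n, q, c) then
  if mkseq (nth (0 : site d) q) n.+1 \in walks n x then set0 else
  frog_cyl omega S [:: x] n (fun=> c) (fun=> nth 0 q) else set0.
apply: (@negligibleS _ _ _ _ (\bigcup_k F k)); last first.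
  apply: negligible_bigcup => k; rewrite /F.
  case: (unpickle k) => [[[[x n] q] c]|]; last exact: negligible_set0.
  case: ifPn => [_|qw]; first exact: negligible_set0.
  have [mC PC] := fm [:: x] n (fun=> c) (fun=> nth 0 q) isT.
  apply/negligibleP => //; apply: (eq_trans PC); rewrite big_seq1 /path_weight; case: ifPn; last by rewrite mulr0.
  move=> /andP[/eqP q0 /forallP qs]; case/negP: qw; apply: mem_walks => // j jn.
  exact: (qs (Ordinal jn)).
move=> t /existsNP[x /existsNP[n /negP xn]].
exists (pickle (x, n, mkseq (fun k => S x k t) n.+1, omega x t)) => //.
rewrite /F pickleK; set q := mkseq _ n.+1 in xn *.
have -> : mkseq (nth 0 q) n.+1 = q.
  by rewrite -[X in mkseq _ X](_ : size q = _) ?mkseq_nth// size_mkseq.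
rewrite (negPf xn) => z; rewrite inE => /eqP ->; split=> // k kn.
by rewrite nth_mkseq.
Qed.

(* [reach omega S t y ys x K]: from [x], the site [y] is reached within total time [K] through
   hops between distinct sites outside [ys]. Membership in [ys] marks the walks already
   revealed. *)
Inductive reach d (T : Type) (omega : site d -> T -> bool)
  (S : site d -> nat -> T -> site d) (t : T) (y : site d) :
  seq (site d) -> site d -> nat -> Prop :=
| reach_here ys K : reach omega S t y ys y K
| reach_hop ys x k K : x \notin ys -> omega x t ->
    (forall j, (j <= k)%N -> S x j t <> S x k.+1 t) ->
    reach omega S t y (x :: ys) (S x k.+1 t) K ->
    reach omega S t y ys x (k.+1 + K).

(** Here [beta] is [1/s]. All walks are revealed up to one horizon [n >= K], beyond which no hop
    within the budget looks. For [ys] empty the bound is [beta^K h(x)]; the cylinder over [ys] is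
    what lets the induction on [K] close. *)
Lemma reach_bound (R : realType) d dsp (T : measurableType dsp)
  (P : probability T R) (r : R) omega (S : site d -> nat -> T -> site d)
  (beta : R) (h : site d -> R) (y : site d) n K x ys b p :
  frog_model P r omega S -> (0 < d)%N -> 0 <= r -> r <= 1 -> 1 <= beta ->
  (forall z, 0 <= h z) -> 1 <= h y ->
  (forall x B K, uniq B ->
     r * (\sum_(z <- B) \sum_(k < K) beta^-1 ^+ k * hit_prob R k (z - x) * h z) <= h x) ->
  (K <= n)%N -> uniq ys ->
  outer_le P (frog_cyl omega S ys n b p `&` walk_good S `&`
              [set t | reach omega S t y ys x K])
    ((\prod_(z <- ys) (bern_weight r (b z) * path_weight R z n (p z))) * beta ^+ K * h x).
Proof.
move=> fm d0 r0 r1 b1 h0 hy hsup.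
(* Conditioning on the walk of [x], and on the first hop, turns the claim for [x :: ys]
   into the claim for [ys]. *)
elim/ltn_ind: K x ys b p => K IHK x ys b p Kn uys.
set w := \prod_(z <- ys) _.
have w0 : 0 <= w.
  apply: prodr_ge0 => z _; rewrite mulr_ge0 ?path_weight_ge0//.
  by rewrite /bern_weight; case: ifP => // _; rewrite subr_ge0.
have [->|xy] := eqVneq x y.
  have [mC PC] := fm ys n b p uys; exists (frog_cyl omega S ys n b p); split => //.
    by move=> t [[]].
  rewrite PC lee_fin -/w -mulrA ler_peMr//.
  by rewrite mulr_ege1// exprn_ege1.
have b0 : 0 < beta by rewrite (lt_le_trans _ b1).
have c0 : 0 <= w * beta ^+ K * h x.
  by rewrite !mulr_ge0// exprn_ge0// ltW.
(* If the walk from [x] is already revealed and [x] is not the target, no constructor of [reach]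
   applies. *)
have [xys|xys] := boolP (x \in ys).
  apply: outer_le_sub (outer_le_set0 P c0) => // t [_ /=] re.
  by inversion re as [|? ? ? ? xn]; subst; [rewrite eqxx in xy|rewrite xys in xn].
(* [B] lists the sites visible to the walk from [x] within the horizon, which keeps the union bound
   finite; [b'] and [p'] add to the cylinder that [x] is occupied and that its walk follows [q]. *)
pose B := undup (flatten (walks n x)).
pose b' z := if z == x then true else b z.
pose p' q z := if z == x then nth 0 q else p z.
pose E z k q : set T := frog_cyl omega S (x :: ys) n b' (p' q) `&` walk_good S `&`
  [set t | reach omega S t y (x :: ys) z (K - k.+1)].
pose D z k := [seq q <- walks n x | index z q == k.+1].
pose c z k := w * r * (2 * d)%:R ^- n * beta ^+ (K - k.+1) * h z.
have hU : outer_le P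
  [set t | exists2 z, z \in B & exists2 k : 'I_K, k \in index_enum 'I_K &
           exists2 q, q \in D z k & E z k q t]
  (\sum_(z <- B) \sum_(k < K) \sum_(q <- D z k) c z k).
  apply: outer_le_bigU => z _; apply: outer_le_bigU => k _; apply: outer_le_bigU => q _.
  have Kk : (K - k.+1 < K)%N by rewrite ltn_subrL /= (leq_ltn_trans _ (ltn_ord k)).
  apply: outer_le_sub (IHK _ Kk z (x :: ys) b' (p' q) _ _) => //; last first.
  - by rewrite /= xys.
  - by rewrite (leq_trans (leq_subr _ _)).
  rewrite big_cons {1}/b' {1}/p' eqxx /=.
  rewrite (@eq_big_seq _ _ _ _ ys _ (fun z => bern_weight r (b z) * path_weight R z n (p z)));
    last first.
    by move=> z' z'ys; rewrite /b' /p'; case: eqVneq => // z'x; rewrite -z'x z'ys in xys.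
  rewrite -/w /c ler_wpM2r// ler_wpM2r ?exprn_ge0 ?(ltW b0)//.
  by rewrite mulrC -mulrA ler_wpM2l// ler_wpM2l// path_weight_le.
apply: outer_le_sub hU.
  move=> t [[cyl gd] re].
  inversion re as [|? ? k K' _ ox fresh re' e1 e2 e3]; subst; first by rewrite eqxx in xy.
  set q := mkseq (fun k => S x k t) n.+1.
  have kn : (k.+1 <= n)%N by rewrite (leq_trans _ Kn)// leq_addr.
  have qw : q \in walks n x by exact: gd.
  exists (S x k.+1 t).
    rewrite mem_undup; apply/flattenP; exists q => //.
    by apply/mapP; exists k.+1; rewrite ?mem_iota.
  have kK : (k < k.+1 + K')%N by rewrite addSn ltnS leq_addr.
  exists (Ordinal kK); first exact: mem_index_enum.
  exists q; first by rewrite mem_filter qw andbT; apply/eqP; apply: index_mkseq.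
  split; last by rewrite /= addKn.
  split => // z; rewrite inE /b' /p'; case: eqVneq => [->|zx] /= => [_|zys].
    by split => // j jn; rewrite nth_mkseq.
  exact: cyl.
(* The number of trajectories in [D z k] is [(2d)^n] times a hitting probability, which cancels the
   weight [(2d)^-n] of each. *)
have -> : \sum_(z <- B) \sum_(k < K) \sum_(q <- D z k) c z k =
  w * beta ^+ K * (r * \sum_(z <- B) \sum_(k < K)
    beta^-1 ^+ k.+1 * hit_prob R k.+1 (z - x) * h z).
  rewrite !mulr_sumr; apply: eq_bigr => z _; rewrite !mulr_sumr; apply: eq_bigr => k _.
  rewrite big_const_seq count_predT iter_addr_0 size_filter -mulr_natr.
  rewrite count_first_visit ?(leq_trans _ Kn)// /c.
  have -> : beta ^+ K = beta ^+ (K - k.+1) * beta ^+ k.+1.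
    by rewrite -exprD subnK.
  rewrite exprVn; field.
  by rewrite !expf_neq0 ?gt_eqF// ltr0n muln_gt0.
rewrite ler_wpM2l ?mulr_ge0 ?exprn_ge0 ?(ltW b0)//.
(* The sum up to [K + 1] in the hypothesis has one more term, of duration zero, which is
   nonnegative. *)
apply: le_trans (hsup x B K.+1 (undup_uniq _)).
rewrite ler_wpM2l//; apply: ler_sum => z _; rewrite [leRHS]big_ord_recl lerDr.
by rewrite !mulr_ge0 ?hit_prob_ge0// exprn_ge0// invr_ge0 ltW.
Qed.

(** * From passage times to self-avoiding hop sequences *)

Definition hop d (T : Type) (omega : site d -> T -> bool)
  (S : site d -> nat -> T -> site d) (t : T) (x z : site d) (k : nat) : Prop :=
  [/\ omega x t, S x k t = z & forall j, (j < k)%N -> S x j t <> z].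

(** [K] is a budget rather than the exact total time, so that hops can be discarded without
    recomputing it. *)
Fixpoint hop_path d (T : Type) (omega : site d -> T -> bool)
  (S : site d -> nat -> T -> site d) (t : T) (x : site d) (p : seq (site d)) (K : nat) :=
  if p is z :: p' then
    exists k, [/\ (k <= K)%N, hop omega S t x z k & hop_path omega S t z p' (K - k)]
  else True.

Lemma hop_path_mono d (T : Type) (omega : site d -> T -> bool) S t x p K K' :
  (K <= K')%N -> hop_path omega S t x p K -> hop_path omega S t x p K'.
Proof.
elim: p x K K' => [//|z p IHp] x K K' KK' /= [k [kK xz zp]]; exists k; split => //.
  exact: leq_trans KK'.
by apply: IHp zp; rewrite leq_sub2r.
Qed.

Lemma hop_path_suffix d (T : Type) (omega : site d -> T -> bool) S t x z q K :
  hop_path omega S t z q K -> x \in z :: q -> uniq (z :: q) ->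
  exists q', [/\ hop_path omega S t x q' K, uniq (x :: q') & last x q' = last z q].
Proof.
elim: q z K => [|u q IHq] z K zq; first by rewrite inE => /eqP -> _; exists [::].
rewrite inE; have [-> _ uq|_ /= xq /andP[_ uq]] := eqVneq x z; first by exists (u :: q).
have [k [kK _ uqK]] := zq.
have [q' [xq' uq' lq']] := IHq u _ uqK xq uq.
by exists q'; split => //; apply: hop_path_mono xq'; rewrite leq_subr.
Qed.

(** Loop erasure from the end of the chain: if [x] recurs in the already erased remainder, the hops
    before that recurrence are dropped, which only saves time. *)
Lemma hop_path_uniq d (T : Type) (omega : site d -> T -> bool) S t x p K :
  hop_path omega S t x p K ->
  exists p', [/\ hop_path omega S t x p' K, uniq (x :: p') & last x p' = last x p].
Proof.
elim: p x K => [|z p IHp] x K; first by exists [::].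
move=> [k [kK xz /IHp[p' [zp' up' lp']]]].
have [xp'|xp'] := boolP (x \in z :: p'); last first.
  by exists (z :: p'); split => //; [exists k|rewrite cons_uniq xp'].
have [q [xq uq lq]] := hop_path_suffix zp' xp' up'.
exists q; split => //; last by rewrite lq lp'.
by apply: hop_path_mono xq; rewrite leq_subr.
Qed.

(** Each departure site joins [ys]; distinctness keeps the later sites outside [ys] and rules out
    hops of duration zero, which would stay in place. *)
Lemma reach_hop_path d (T : Type) (omega : site d -> T -> bool) S t x p K ys :
  (forall z, S z 0%N t = z) -> hop_path omega S t x p K -> uniq (x :: p) ->
  (forall z, z \in x :: p -> z \notin ys) -> reach omega S t (last x p) ys x K.
Proof.
move=> S0; elim: p x K ys => [|z p IHp] x K ys; first by move=> *; apply: reach_here.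
move=> [[|k] [kK [ox xz fresh] zp]] /andP[xp up] dis.
  by move: xp; rewrite -xz S0 mem_head.
rewrite -(subnKC kK); apply: reach_hop => //.
- by apply: dis; rewrite mem_head.
- by move=> j jk; rewrite xz; apply: fresh.
- rewrite xz /=; apply: IHp => // u up'; rewrite inE negb_or dis ?andbT.
    by apply: contraNneq xp => <-.
  by rewrite inE up' orbT.
Qed.

(** A finite infimum of natural numbers is attained, and the minimal visiting time is a first
    visit. *)
Lemma hit_time_hop (R : realType) d (T : Type) (omega : site d -> T -> bool) S x z t :
  (hit_time R omega S x z t < +oo)%E ->
  exists2 k : nat, hit_time R omega S x z t = (k%:R)%:E & hop omega S t x z k.
Proof.
rewrite /hit_time; case: ifP => // ox lty.
have ex : exists k, S x k t == z.
  by have /ereal_inf_lt[_ [k /= /eqP xz _] _] := lty; exists k.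
have [k /eqP xz kmin] := ex_minnP ex.
exists k; last by split => // j jk /eqP/kmin; rewrite leqNgt jk.
apply/eqP; rewrite eq_le; apply/andP; split; first by apply: ereal_inf_lbound; exists k.
apply: le_ereal_inf_tmp => _ [j /= /eqP/kmin kj <-].
by rewrite lee_fin ler_nat.
Qed.

Lemma hit_time_ge0 (R : realType) d (T : Type) (omega : site d -> T -> bool) S x z t :
  (0 <= hit_time R omega S x z t)%E.
Proof.
rewrite /hit_time; case: ifP => // _.
by apply: le_ereal_inf_tmp => _ [j _ <-]; rewrite lee_fin.
Qed.

Lemma sum_hit_time_path (R : realType) d (T : Type) (omega : site d -> T -> bool) S t m
  (xs : nat -> site d) :
  (\sum_(i < m) hit_time R omega S (xs i) (xs i.+1) t < +oo)%E ->
  exists p K, [/\ (\sum_(i < m) hit_time R omega S (xs i) (xs i.+1) t = (K%:R)%:E)%E,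
    hop_path omega S t (xs 0%N) p K & last (xs 0%N) p = xs m].
Proof.
elim: m xs => [|m IHm] xs lty; first by exists [::], 0%N; rewrite big_ord0.
move: lty; rewrite big_ord_recl /= => lty.
have [|k hk xk] := @hit_time_hop R d T omega S (xs 0%N) (xs 1%N) t.
  by apply: le_lt_trans lty; rewrite leeDl// sume_ge0// => i _; apply: hit_time_ge0.
have [|p [K [hK xp lp]]] := IHm (xs \o succn).
  by apply: le_lt_trans lty; rewrite leeDr// hit_time_ge0.
exists (xs 1%N :: p), (k + K)%N; split => //=.
  by rewrite hk natrD EFinD; congr (_ + _)%E.
by exists k; split => //; rewrite ?leq_addr// addKn.
Qed.

(** A strict bound on the infimum yields a chain of cost below [c], whose hitting times are all
    finite; loop erasure keeps its endpoints and budget. *)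
Lemma passage_time_reach (R : realType) d (T : Type) (omega : site d -> T -> bool) S t
  (x y : site d) (c : R) : (forall z, S z 0%N t = z) ->
  (passage_time R omega S x y t < c%:E)%E ->
  exists2 K : nat, K%:R < c & reach omega S t y [::] x K.
Proof.
move=> S0 /ereal_inf_lt[_ [m [xs [x0 [xm ->]]]]] ltc.
have [p [K [sK xp lp]]] := sum_hit_time_path (lt_trans ltc (ltry c)).
move: ltc; rewrite sK lte_fin => Kc; exists K => //.
have [p' [xp' up' lp']] := hop_path_uniq xp.
by rewrite -xm -lp -lp' -x0; apply: reach_hop_path.
Qed.

Lemma reach_mono d (T : Type) (omega : site d -> T -> bool) S t (y : site d) ys x K K' :
  (K <= K')%N -> reach omega S t y ys x K -> reach omega S t y ys x K'.
Proof.
move=> KK' xK; elim: xK K' KK' => [{}ys {}K|{}ys {}x k {}K xys ox fresh _ IH] K' kK'; first exact: reach_here.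
by rewrite -(subnKC (leq_trans (leq_addr _ _) kK')); apply: reach_hop => //; apply: IH; lia.
Qed.

(** * Exponential tilting *)

(** With [sigma] the signs of the coordinates of [x], this linear form equals the [l1] norm at [x]
    and changes by at most one per step of the walk. *)
Definition tilt d (sigma : 'I_d -> int) (z : site d) : int := \sum_i sigma i * z 0 i.

Lemma tiltD d (sigma : 'I_d -> int) x y : tilt sigma (x + y) = tilt sigma x + tilt sigma y.
Proof. by rewrite -big_split; apply: eq_bigr => i _; rewrite mxE mulrDr. Qed.

Lemma tiltN d (sigma : 'I_d -> int) x : tilt sigma (- x) = - tilt sigma x.
Proof. by rewrite /tilt -sumrN; apply: eq_bigr => i _; rewrite mxE mulrN. Qed.

Lemma tilt_delta d (sigma : 'I_d -> int) i : tilt sigma (delta_mx 0 i) = sigma i.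
Proof.
rewrite /tilt (bigD1 i)//= mxE !eqxx mulr1 big1 ?addr0// => j ji.
by rewrite mxE (negPf ji) andbF mulr0.
Qed.

Lemma exprz_add_inv_le (R : realType) (a : R) (m : int) : 0 < a -> (`|m| <= 1)%N ->
  a ^ m + a ^ (- m) <= a + a^-1.
Proof.
move=> a0; case: m => [[|[|m]]|[|m]]//= _; last by rewrite addrC.
rewrite oppr0 expr0z -subr_ge0.
have -> : a + a^-1 - (1 + 1) = (a - 1) ^+ 2 / a by field; rewrite gt_eqF.
by rewrite divr_ge0 ?sqr_ge0// ltW.
Qed.

Lemma sum_unit_step_tilt (R : realType) d (sigma : 'I_d -> int) (a : R) :
  0 < a -> (forall i, `|sigma i| <= 1)%N ->
  \sum_(w : 'I_d * bool) a ^ tilt sigma (unit_step w) <= d%:R * (a + a^-1).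
Proof.
move=> a0 hs; rewrite -(pair_bigA _ (fun i b => a ^ tilt sigma (unit_step (i, b)))) /=.
rewrite -[d in d%:R]card_ord mulr_natl -sumr_const; apply: ler_sum => i _.
rewrite big_bool /= /unit_step /= tiltN tilt_delta.
exact: exprz_add_inv_le.
Qed.

(** Opposite steps pair up, so one step multiplies the exponential moment by at most
    [(a + 1/a) / 2]. Finite lists [B] without repetition stand for the lattice, and conditioning on
    the first step translates them. *)
Lemma walk_prob_tilt (R : realType) d (sigma : 'I_d -> int) (a : R) n B :
  (0 < d)%N -> 0 < a -> (forall i, `|sigma i| <= 1)%N -> uniq B ->
  \sum_(z <- B) walk_prob R n z * a ^ tilt sigma z <= ((a + a^-1) / 2) ^+ n.
Proof.
move=> d0 a0 hs; elim: n B => [|n IHn] B uB.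
  have tilt0 : tilt sigma 0 = 0 by rewrite /tilt big1// => i _; rewrite mxE mulr0.
  rewrite expr0; have [B0|B0] := boolP (0 \in B).
    rewrite (bigD1_seq 0)//= eqxx tilt0 expr0z mulr1 big1 ?addr0// => z z0.
    by rewrite (negPf z0) mul0r.
  rewrite big_seq big1// => z zB; rewrite /=; case: eqVneq zB => [->|_ _].
    by rewrite (negPf B0).
  by rewrite mul0r.
under eq_bigr => z _ do rewrite /= -mulrA mulr_suml.
rewrite -mulr_sumr exchange_big /= exprS.
have stepE (w : 'I_d * bool) :
    \sum_(z <- B) walk_prob R n (z - unit_step w) * a ^ tilt sigma z <=
    a ^ tilt sigma (unit_step w) * ((a + a^-1) / 2) ^+ n.
  apply: (@le_trans _ _ (a ^ tilt sigma (unit_step w) *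
    \sum_(z <- [seq z - unit_step w | z <- B]) walk_prob R n z * a ^ tilt sigma z)).
    rewrite big_map mulr_sumr; apply: ler_sum => z _.
    rewrite mulrCA -expfzDr ?gt_eqF// -tiltD.
    by rewrite [unit_step w + _]addrC subrK.
  rewrite ler_wpM2l ?exprz_ge0 ?(ltW a0)//; apply: IHn.
  by rewrite map_inj_uniq//; apply: addIr.
have phi0 : 0 <= (a + a^-1) / 2 by rewrite divr_ge0 ?addr_ge0 ?invr_ge0 ?(ltW a0).
apply: (@le_trans _ _ ((2 * d)%:R^-1 *
    (\sum_(w : 'I_d * bool) a ^ tilt sigma (unit_step w) * ((a + a^-1) / 2) ^+ n))).
  by rewrite ler_wpM2l ?invr_ge0 ?ler0n// ler_sum.
rewrite -mulr_suml mulrA ler_wpM2r ?exprn_ge0//.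
rewrite natrM invfM -mulrA -[leRHS]mulrC ler_wpM2l//.
by rewrite mulrC ler_pdivrMr ?ltr0n// mulrC sum_unit_step_tilt.
Qed.

Lemma ler_sum_ord_widen (R : realType) (F : nat -> R) m n : (m <= n)%N ->
  (forall i, 0 <= F i) -> \sum_(i < m) F i <= \sum_(i < n) F i.
Proof.
move=> mn F0; rewrite -!(big_mkord xpredT F) (big_cat_nat _ mn)//= lerDl.
by rewrite sumr_ge0.
Qed.

(** By [renewal], a first visit at time [k] followed by a return after [j] more steps contributes to
    time [n = k + j < K + J]; the right-hand side contains all these pairs and further nonnegative
    ones. *)
Lemma hit_green_le (R : realType) d (s : R) K J (z : site d) : 0 <= s ->
  (\sum_(k < K) s ^+ k * hit_prob R k z) *
    (\sum_(j < J) s ^+ j * walk_prob R j (0 : site d)) <=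
  \sum_(n < K + J) s ^+ n * walk_prob R n z.
Proof.
move=> s0; set N := (K + J)%N.
pose c n k := if (k <= n)%N then
  s ^+ n * (hit_prob R k z * walk_prob R (n - k) (0 : site d)) else 0.
have c0 n k : 0 <= c n k.
  by rewrite /c; case: ifP => // _; rewrite !mulr_ge0 ?hit_prob_ge0 ?walk_prob_ge0 ?exprn_ge0.
have -> : \sum_(n < N) s ^+ n * walk_prob R n z = \sum_(n < N) \sum_(k < N) c n k.
  apply: eq_bigr => n _; rewrite renewal mulr_sumr.
  rewrite (big_ord_widen N (fun k => s ^+ n *
    (hit_prob R k z * walk_prob R (n - k) (0 : site d))))//.
  by rewrite big_mkcond; apply: eq_bigr => k _; rewrite /c ltnS.
rewrite exchange_big /= mulr_suml.
apply: le_trans (@ler_sum_ord_widen _ (fun k => \sum_(n < N) c n k) K N _ _);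
  rewrite ?leq_addr//; last by move=> k; apply: sumr_ge0.
apply: ler_sum => k _.
rewrite -(big_mkord xpredT (fun n => c n k)) (@big_cat_nat _ _ _ k)//=; last first.
  by rewrite (leq_trans (ltnW (ltn_ord k)))// leq_addr.
apply: (@le_trans _ _ (\sum_(k <= n < N) c n k)); last by rewrite lerDr sumr_ge0.
have -> : \sum_(k <= n < N) c n k = \sum_(j < N - k) c (j + k)%N k.
  by rewrite -{1}[nat_of_ord k]add0n big_addn big_mkord.
apply: le_trans (@ler_sum_ord_widen _ (fun j => c (j + k)%N k) J _ _ _) => //; last first.
  by rewrite /N; have := ltn_ord k; lia.
rewrite mulr_sumr; apply: ler_sum => j _.
by rewrite /c leq_addl addnK exprD; rewrite le_eqVlt; apply/orP; left; apply/eqP; ring.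
Qed.

Lemma geometric_sum_le (R : realType) (q : R) n : 0 <= q -> q < 1 ->
  \sum_(i < n) q ^+ i <= (1 - q)^-1.
Proof.
move=> q0 q1; have q1' : 0 < 1 - q by rewrite subr_gt0.
rewrite -[leRHS]mul1r ler_pdivlMr// mulrC -[X in X * _]opprB mulNr -subrX1 opprB.
by rewrite gerBl exprn_ge0.
Qed.

(** Multiplicativity of the tilt reduces the claim to [r X <= 1]. By [hit_green_le] and
    [walk_prob_tilt], [X G] is at most a geometric series of ratio [s phi], hence at most
    [4 / eta^2]. *)
Lemma hit_prob_supermartingale (R : realType) d (sigma : 'I_d -> int) (r eta G : R) J
  (x y : site d) B K :
  (0 < d)%N -> (forall i, `|sigma i| <= 1)%N -> 0 < eta -> eta <= 1 -> 0 <= r ->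
  0 < G -> r * (4 / eta ^+ 2) <= G ->
  G <= \sum_(j < J) (1 + eta ^+ 2)^-1 ^+ j * walk_prob R j (0 : site d) ->
  uniq B ->
  r * (\sum_(z <- B) \sum_(k < K)
        (1 + eta ^+ 2)^-1 ^+ k * hit_prob R k (z - x) * (1 + eta) ^ tilt sigma (z - y))
    <= (1 + eta) ^ tilt sigma (x - y).
Proof.
move=> d0 hs e0 e1 r0 G0 rG GJ uB.
set s := (1 + eta ^+ 2)^-1 in GJ *; set a := 1 + eta.
have a0 : 0 < a by rewrite addr_gt0.
have s0 : 0 <= s by rewrite invr_ge0 addr_ge0// sqr_ge0.
pose B' := [seq z - x | z <- B].
have uB' : uniq B' by rewrite map_inj_uniq//; apply: addIr.
pose X := \sum_(z <- B') (\sum_(k < K) s ^+ k * hit_prob R k z) * a ^ tilt sigma z.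
have -> : \sum_(z <- B) \sum_(k < K) s ^+ k * hit_prob R k (z - x) * a ^ tilt sigma (z - y)
    = X * a ^ tilt sigma (x - y).
  rewrite /X big_map mulr_suml; apply: eq_bigr => z _; rewrite !mulr_suml.
  apply: eq_bigr => k _; rewrite -!mulrA; congr (_ * (_ * _)).
  by rewrite -expfzDr ?gt_eqF// -tiltD addrA subrK.
rewrite mulrA ler_piMl ?exprz_ge0 ?(ltW a0)//.
pose phi := (a + a^-1) / 2.
have phi0 : 0 <= phi by rewrite divr_ge0// addr_ge0// ?invr_ge0 ltW.
(* Since [a >= 1], [phi <= 1 + eta^2 / 2]; dividing by [1 + eta^2] leaves at most [1 - eta^2 / 4]
   because [eta^2 <= 1]. *)
have sphi : s * phi <= 1 - eta ^+ 2 / 4.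
  have -> : phi = 1 + eta ^+ 2 / (2 * a).
    by rewrite /phi /a; field; rewrite gt_eqF.
  rewrite /s mulrC ler_pdivrMr; last by rewrite addr_gt0// exprn_gt0.
  have : eta ^+ 2 / (2 * a) <= eta ^+ 2 / 2.
    rewrite ler_wpM2l ?sqr_ge0// lef_pV2 ?posrE ?mulr_gt0//.
    by rewrite ler_peMr// /a lerDl ltW.
  have := sqr_ge0 eta; have : eta ^+ 2 <= 1 by rewrite expr_le1// ltW.
  move: (eta ^+ 2) (eta ^+ 2 / (2 * a)) => u v; nra.
have e20 : 0 < eta ^+ 2 by rewrite exprn_gt0.
have XG : X * G <= 4 / eta ^+ 2.
  apply: (@le_trans _ _ (\sum_(n < K + J) (s * phi) ^+ n)); last first.
    apply: le_trans (geometric_sum_le _ _ _) _.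
    - by rewrite mulr_ge0.
    - by rewrite (le_lt_trans sphi)// gtrBl divr_gt0.
    - have q4 : 0 < eta ^+ 2 / 4 by rewrite divr_gt0.
      have q0 : 0 < 1 - s * phi by lra.
      by rewrite -[4 / _]invf_div lef_pV2 ?posrE//; lra.
  rewrite /X mulr_suml.
  apply: (@le_trans _ _ (\sum_(z <- B') \sum_(n < K + J) s ^+ n *
      (walk_prob R n z * a ^ tilt sigma z))).
    apply: ler_sum => z _; rewrite mulrAC.
    have -> : \sum_(n < K + J) s ^+ n * (walk_prob R n z * a ^ tilt sigma z) =
        (\sum_(n < K + J) s ^+ n * walk_prob R n z) * a ^ tilt sigma z.
      by rewrite mulr_suml; apply: eq_bigr => n _; rewrite mulrA.
    rewrite ler_wpM2r ?exprz_ge0 ?(ltW a0)//.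
    apply: le_trans (hit_green_le K J z s0); rewrite ler_wpM2l//.
    by apply: sumr_ge0 => k _; rewrite mulr_ge0 ?hit_prob_ge0 ?exprn_ge0.
  rewrite exchange_big; apply: ler_sum => n _ /=.
  by rewrite -mulr_sumr exprMn ler_wpM2l ?exprn_ge0// walk_prob_tilt.
rewrite -(ler_pM2r G0) mul1r -mulrA.
by rewrite (le_trans _ rG)// ler_wpM2l.
Qed.

(** * The planar Green function *)

Fixpoint walk1_prob (R : realType) n (a : int) : R :=
  if n is n'.+1 then (walk1_prob R n' (a - 1) + walk1_prob R n' (a + 1)) / 2
  else (a == 0)%:R.

(* In the coordinates z0 + z1 and z0 - z1 the planar walk is a pair of independent
   one-dimensional walks. *)
Lemma walk_prob_diagonal (R : realType) n (z : site 2) :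
  walk_prob R n z = walk1_prob R n (z 0 0 + z 0 1) * walk1_prob R n (z 0 0 - z 0 1).
Proof.
elim: n z => [|n IHn] z /=.
  rewrite -natrM mulnb; congr (_%:R); congr (nat_of_bool _).
  apply/eqP/andP => [->|[/eqP h1 /eqP h2]]; first by rewrite !mxE.
  apply/rowP => i; rewrite mxE; have [->|->] : i = 0 \/ i = 1.
  - by case: i => [[|[|]]] // p; [left|right]; apply/val_inj.
  - by move: h1 h2; move: (z 0 0) (z 0 1) => a b; lia.
  - by move: h1 h2; move: (z 0 0) (z 0 1) => a b; lia.
rewrite -(pair_bigA _ (fun i b => walk_prob R n (z - unit_step (i, b)))) /=.
rewrite !big_ord_recl big_ord0 !big_bool !IHn /unit_step /= !mxE /=.
rewrite !(subr0, oppr0, addr0, opprK).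
move: (z 0 0) (z 0 1) => a b.
have e1 : a - 1 + b = a + b - 1 by lia.
have e2 : a - 1 - b = a - b - 1 by lia.
have e3 : a + 1 + b = a + b + 1 by lia.
have e4 : a + 1 - b = a - b + 1 by lia.
have e5 : a + (b - 1) = a + b - 1 by lia.
have e6 : a - (b - 1) = a - b + 1 by lia.
have e7 : a + (b + 1) = a + b + 1 by lia.
have e8 : a - (b + 1) = a - b - 1 by lia.
rewrite e1 e2 e3 e4 e5 e6 e7 e8.
by field.
Qed.

Lemma walk1_prob_out (R : realType) n (a : int) : a < - n%:Z -> walk1_prob R n a = 0.
Proof.
elim: n a => [|n IHn] a an /=; first by case: eqP => // a0; move: an; rewrite a0; lia.
by rewrite !IHn ?addr0 ?mul0r//; lia.
Qed.

(** [j] is the number of upward steps, and the recursion is Pascal's rule. *)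
Lemma walk1_prob_binomial (R : realType) n j :
  walk1_prob R n (2 * j%:Z - n%:Z) = 'C(n, j)%:R / 2 ^+ n.
Proof.
elim: n j => [|n IHn] j /=.
  by rewrite subr0 mulf_eq0 /= divr1; case: j.
have -> : 2 * j%:Z - n.+1%:Z + 1 = 2 * j%:Z - n%:Z by lia.
rewrite IHn exprS; case: j => [|j].
  rewrite walk1_prob_out ?bin0; last by lia.
  by field; rewrite expf_neq0.
have -> : 2 * j.+1%:Z - n.+1%:Z - 1 = 2 * j%:Z - n%:Z by lia.
rewrite IHn binS natrD; field.
by rewrite expf_neq0.
Qed.

Lemma central_binomial_step k :
  (k.+1 * 'C(2 * k.+1, k.+1) = 2 * (2 * k + 1) * 'C(2 * k, k))%N.
Proof.
have e1 : (2 * k.+1 = (2 * k).+2)%N by lia.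
have h1 := mul_bin_diag (2 * k).+2 k; have h2 := mul_bin_diag (2 * k).+1 k.
have h3 : 'C((2 * k).+1, k.+1) = 'C((2 * k).+1, k).
  have kk : (k <= (2 * k).+1)%N by lia.
  by rewrite -(bin_sub kk); congr 'C(_, _); lia.
rewrite /= h3 in h2; rewrite /= in h1; rewrite e1.
by rewrite -h1; move: h2; move: 'C(_, _) 'C(_, _) => a b; nia.
Qed.

(** With [m = k + 1], the induction step multiplies the square by [((2m+1) / (2m+2))^2], which
    exceeds [m / (m+1)]; equality holds for [k = 0]. *)
Lemma central_binomial_ge (R : realType) k :
  1 / (4 * k.+1%:R) <= ('C(2 * k.+1, k.+1)%:R / 2 ^+ (2 * k.+1)) ^+ 2 :> R.
Proof.
elim: k => [|k IHk].
  by rewrite !muln1 bin1 /=; lra.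
have := congr1 (fun m => m%:R : R) (central_binomial_step k.+1).
rewrite !natrM natrD natrM.
have -> : (2 * k.+2 = (2 * k.+1).+2)%N by lia.
set C' := 'C(_, k.+2)%:R; set C := 'C(_, k.+1)%:R => eC.
rewrite (exprS _ (2 * k.+1).+1) (exprS _ (2 * k.+1)); set p := 2 ^+ (2 * k.+1) in IHk *.
have p0 : 0 < p by rewrite exprn_gt0.
have k2 : k.+2%:R = k.+1%:R + 1 :> R by rewrite -natr1.
rewrite k2 in eC *.
have k0 : 0 < k.+1%:R :> R by rewrite ltr0n.
move: (k.+1%:R : R) k0 eC IHk => m m0 eC IHk.
have -> : C' = 2 * (2 * m + 1) * C / (m + 1).
  by rewrite -eC; field; rewrite gt_eqF// addr_gt0.
have -> : (2 * (2 * m + 1) * C / (m + 1) / (2 * (2 * p))) ^+ 2 =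
    ((2 * m + 1) / (2 * (m + 1))) ^+ 2 * (C / p) ^+ 2.
  by field; rewrite !gt_eqF// addr_gt0.
apply: (@le_trans _ _ (((2 * m + 1) / (2 * (m + 1))) ^+ 2 * (1 / (4 * m)))); last first.
  by rewrite ler_wpM2l ?sqr_ge0.
rewrite -subr_ge0.
have -> : ((2 * m + 1) / (2 * (m + 1))) ^+ 2 * (1 / (4 * m)) - 1 / (4 * (m + 1)) =
    1 / (16 * m * (m + 1) ^+ 2).
  by field; rewrite !gt_eqF// addr_gt0.
by rewrite divr_ge0// !mulr_ge0 ?exprn_ge0// ltW// addr_gt0.
Qed.

Lemma walk_prob_return_ge (R : realType) k :
  1 / (4 * k.+1%:R) <= walk_prob R (2 * k.+1) (0 : site 2).
Proof.
rewrite walk_prob_diagonal !mxE subr0 -expr2.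
have -> : (0 : int) = 2 * k.+1%:Z - (2 * k.+1)%N%:Z by lia.
by rewrite walk1_prob_binomial central_binomial_ge.
Qed.

Lemma ler_sum_even (R : realType) (F : nat -> R) M : (forall i, 0 <= F i) ->
  \sum_(k < M) F (2 * k.+1)%N <= \sum_(j < (2 * M).+1) F j.
Proof.
move=> F0; elim: M => [|M IHM]; first by rewrite big_ord0 sumr_ge0.
have -> : ((2 * M.+1).+1 = (2 * M).+3)%N by lia.
rewrite big_ord_recr 2!big_ord_recr /=.
have -> : (2 * M.+1 = (2 * M).+2)%N by lia.
by rewrite lerD2r (le_trans IHM)// lerDl.
Qed.

Lemma ln_le_harmonic (R : realType) M : ln M.+1%:R <= \sum_(k < M) k.+1%:R^-1 :> R.
Proof.
elim: M => [|M IHM]; first by rewrite ln1 sumr_ge0.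
rewrite big_ord_recr /=.
have M0 : 0 < M.+1%:R :> R by [].
have -> : M.+2%:R = M.+1%:R * (1 + M.+1%:R^-1) :> R.
  by rewrite mulrDr mulr1 divff ?gt_eqF// -natr1.
have i0 : 0 < M.+1%:R^-1 :> R by rewrite invr_gt0.
rewrite lnM ?posrE ?addr_gt0// lerD// le_ln1Dx//.
by rewrite (lt_trans _ i0)// ltrN10.
Qed.

(** Only positive even times up to [2/u] are kept: there the discount is at least [e^-2] and the
    return probability after [2(k+1)] steps at least [1/(4(k+1))]. The harmonic sum that remains is
    at least [ln(1/u)]. *)
Lemma green_lower_planar (R : realType) (u : R) : 0 < u ->
  exists J, expR (- 2) / 4 * ln u^-1 <=
    \sum_(j < J) (1 + u)^-1 ^+ j * walk_prob R j (0 : site 2).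
Proof.
move=> u0; set M := Num.trunc u^-1.
have ui0 : 0 < u^-1 by rewrite invr_gt0.
have /andP[Mu uM] := truncn_itv (ltW ui0).
have v0 : 0 < 1 + u by rewrite addr_gt0.
exists (2 * M).+1.
apply: le_trans (@ler_sum_even _ (fun j => (1 + u)^-1 ^+ j * walk_prob R j (0 : site 2)) M _);
  last by move=> j; rewrite mulr_ge0 ?walk_prob_ge0// exprn_ge0// invr_ge0 ltW.
apply: (@le_trans _ _ (expR (- 2) / 4 * \sum_(k < M) k.+1%:R^-1)).
  rewrite ler_wpM2l ?divr_ge0 ?expR_ge0// (le_trans _ (ln_le_harmonic _ _))//.
  by rewrite ler_ln ?posrE// ltW.
rewrite mulr_sumr; apply: ler_sum => k _.
apply: (@le_trans _ _ (expR (- 2) * (1 / (4 * k.+1%:R)))).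
  by rewrite mul1r invfM mulrA.
apply: ler_pM; rewrite ?expR_ge0 ?divr_ge0// ?walk_prob_return_ge//.
rewrite expRN exprVn lef_pV2 ?posrE ?expR_gt0 ?exprn_gt0//.
apply: (@le_trans _ _ (expR u ^+ (2 * k.+1))).
  by rewrite lerXn2r ?nnegrE ?expR_ge0 ?(ltW v0)// expR_ge1Dx.
rewrite -expRM_natl ler_expR natrM -mulrA ler_piMr//.
rewrite -ler_pdivlMr// mul1r (le_trans _ Mu)// ler_nat.
exact: ltn_ord.
Qed.

(** * Lower bound for the time constant *)

Lemma tilt_sg_l1norm (R : realType) d (x : site d) :
  (tilt (fun i => Num.sg (x 0 i)) x)%:~R = l1norm (to_real R x).
Proof.
rewrite /tilt /l1norm (rmorph_sum (intmul 1)); apply: eq_bigr => i _.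
by rewrite -normrEsg mxE -intr_norm.
Qed.

(** With [c = L n / (4 eta)], the time factor is at most [exp(eta^2 c) = exp(eta L n / 4)], while
    [h(0) = (1 + eta)^(-L n) <= exp(-eta L n / 2)]; half of the decay survives. *)
Lemma passage_time_tail (R : realType) d dsp (T : measurableType dsp)
  (P : probability T R) (r eta G : R) J omega (S : site d -> nat -> T -> site d)
  (x : site d) (n : nat) :
  frog_model P r omega S -> (0 < d)%N -> 0 <= r -> r <= 1 -> 0 < eta -> eta <= 1 ->
  0 < G -> r * (4 / eta ^+ 2) <= G ->
  G <= \sum_(j < J) (1 + eta ^+ 2)^-1 ^+ j * walk_prob R j (0 : site d) ->
  let L := l1norm (to_real R x) in
  outer_le P ([set t | (passage_time R omega S 0%R (x *+ n)%R t < (L / (4 * eta) * n%:R)%:E)%E]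
              `&` walk_good S)
    (expR (- (eta / 4 * L * n%:R))).
Proof.
move=> fm d0 r0 r1 e0 e1 G0 rG GJ L.
pose sigma i := Num.sg (x 0 i).
pose c := L / (4 * eta) * n%:R.
have L0 : 0 <= L by apply: sumr_ge0.
have c0 : 0 <= c by rewrite mulr_ge0// divr_ge0// mulr_ge0// ltW.
have a0 : 0 < 1 + eta by rewrite addr_gt0.
have hs i : (`|sigma i| <= 1)%N by rewrite /sigma; case: sgrP.
have b1 : 1 <= 1 + eta ^+ 2 by rewrite lerDl sqr_ge0.
pose h z := (1 + eta) ^ tilt sigma (z - x *+ n).
have h0 z : 0 <= h z by rewrite exprz_ge0// ltW.
have hy : 1 <= h (x *+ n).
  by rewrite /h subrr /tilt big1 ?expr0z// => i _; rewrite mxE mulr0.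
have hK : (Num.trunc c <= Num.trunc c)%N by [].
have := reach_bound (n := Num.trunc c) (ys := [::]) 0 (fun=> true) (fun=> fun=> 0)
  fm d0 r0 r1 b1 h0 hy _ hK isT.
have hsup z B K : uniq B -> r * (\sum_(z' <- B) \sum_(k < K)
    (1 + eta ^+ 2)^-1 ^+ k * hit_prob R k (z' - z) * h z') <= h z.
  by move=> uB; apply: (hit_prob_supermartingale z (x *+ n) K d0 hs e0 e1 r0 G0 rG GJ uB).
move=> /(_ hsup); rewrite big_nil mul1r; apply: outer_le_sub.
  move=> t [/= Tc gt]; split; first by split.
  have S0 z : S z 0%N t = z by have := gt z 0%N; rewrite inE => /eqP[].
  have [K Kc] := passage_time_reach S0 Tc.
  by apply: reach_mono; rewrite truncn_ge_nat// ltW.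
apply: (@le_trans _ _ (expR (eta ^+ 2 * c) * expR (- (eta / 2) * (L * n%:R)))).
  apply: ler_pM => //; first by rewrite exprn_ge0// (le_trans _ b1).
    apply: (@le_trans _ _ (expR (eta ^+ 2) ^+ Num.trunc c)).
      rewrite lerXn2r ?nnegrE ?expR_ge0 ?expR_ge1Dx//.
      by rewrite (le_trans _ b1).
    rewrite -expRM_natr ler_expR ler_wpM2l ?sqr_ge0//.
    by have /andP[] := truncn_itv c0.
  have tiltx : (`|tilt sigma x|%N)%:R = L.
    rewrite /L -(tilt_sg_l1norm R x) -/sigma natr_absz ger0_norm//.
    by apply: sumr_ge0 => i _; rewrite -normrEsg.
  have tilt_ge0 : 0 <= tilt sigma x by apply: sumr_ge0 => i _; rewrite -normrEsg.
  have tiltMn : tilt sigma (x *+ n) = (`|tilt sigma x| * n)%N.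
    elim: n {c c0 h h0 hy hK hsup} => [|n IHn].
      by rewrite /tilt big1 ?muln0// => i _; rewrite mxE mulr0.
    by rewrite mulrS tiltD IHn mulnS PoszD gez0_abs.
  rewrite /h sub0r tiltN tiltMn -exprz_inv -exprnP.
  rewrite -tiltx -natrM expRM_natr lerXn2r ?nnegrE ?expR_ge0 ?invr_ge0 ?(ltW a0)//.
  (* [1/(1 + eta) = 1 - eta/(1 + eta) <= exp(-eta/(1 + eta))], and [eta <= 1] bounds the exponent by
     [-eta/2]. *)
  apply: (@le_trans _ _ (1 - eta / (1 + eta))).
    by rewrite le_eqVlt; apply/orP; left; apply/eqP; field; rewrite gt_eqF.
  apply: le_trans (expR_ge1Dx _) _; rewrite ler_expR lerN2.
  by rewrite ler_wpM2l ?(ltW e0)// lef_pV2 ?posrE//; lra.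
rewrite -expRD ler_expR /c le_eqVlt; apply/orP; left; apply/eqP; field.
by rewrite gt_eqF.
Qed.

(** If [mu] were smaller, then almost surely on [omega 0] the events [E n] would hold for all large
    [n]. Their probabilities tend to zero, so this has probability zero, whereas the origin is
    occupied with probability [r > 0]. *)
Lemma time_constant_ge_int (R : realType) d (r eta G : R) J mu (x : site d) :
  is_time_constant r mu -> (0 < d)%N -> 0 < r -> r <= 1 -> 0 < eta -> eta <= 1 ->
  0 < G -> r * (4 / eta ^+ 2) <= G ->
  G <= \sum_(j < J) (1 + eta ^+ 2)^-1 ^+ j * walk_prob R j (0 : site d) ->
  l1norm (to_real R x) / (4 * eta) <= mu (to_real R x).
Proof.
move=> [[mu0 _] [dsp [T [P [omega [S [fm ae]]]]]]] d0 r0 r1 e0 e1 G0 rG GJ.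
rewrite leNgt; apply/negP => mu_lt.
set L := l1norm (to_real R x) in mu_lt; set c := L / (4 * eta) in mu_lt.
have L0 : 0 < L.
  have : 0 < c by apply: le_lt_trans mu_lt.
  by rewrite /c pmulr_lgt0// invr_gt0 mulr_gt0.
pose E n := [set t | (passage_time R omega S 0%R (x *+ n)%R t < (c * n%:R)%:E)%E]
              `&` walk_good S.
have hE n : outer_le P (E n) (expR (- (eta / 4 * L * n%:R))).
  exact: passage_time_tail fm d0 (ltW r0) r1 e0 e1 G0 rG GJ.
have negl N : P.-negligible (\bigcap_(n in [set n | (N <= n)%N]) E n).
  apply: outer_le_negligible => e epos.
  set g := eta / 4 * L; have g0 : 0 < g by rewrite mulr_gt0// divr_gt0.
  (* This [n] gives [exp(g n) >= 1 + g n >= 1/e]. *)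
  pose n := maxn N (Num.trunc (e * g)^-1).+1.
  have eg0 : 0 < e * g by rewrite mulr_gt0.
  apply: outer_le_sub (hE n); first by apply: bigcap_inf; rewrite /= leq_maxl.
  rewrite expRN -/g -[leRHS]invrK lef_pV2 ?posrE ?invr_gt0 ?expR_gt0//.
  apply: le_trans (expR_ge1Dx _); rewrite -lerBlDl.
  apply: (@le_trans _ _ (g * (e * g)^-1)).
    by rewrite invfM mulrCA divff ?gt_eqF// mulr1 gerBl.
  rewrite ler_wpM2l ?(ltW g0)// (le_trans (ltW (truncnS_gt _)))//.
  by rewrite ler_nat leq_maxr.
have mC := fm [:: 0] 0%N (fun=> true) (fun=> fun=> 0) isT.
have : P.-negligible (frog_cyl omega S [:: 0] 0 (fun=> true) (fun=> fun=> 0)).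
  apply: (@negligibleS _ _ _ _ (~` [set t | omega 0 t -> forall x : site d,
      (fun n : nat => ((n%:R)^-1)%:E * passage_time R omega S 0%R (x *+ n)%R t)%E
        @ \oo --> (mu (to_real R x))%:E] `|` ~` walk_good S `|`
      \bigcup_N \bigcap_(n in [set n | (N <= n)%N]) E n)); last first.
    apply: negligibleU; first apply: negligibleU => //.
    - exact: walk_good_ae fm.
    - exact: negligible_bigcup.
  move=> t /(_ 0 (mem_head _ _)) [w0 _].
  have [gt|] := pselect (walk_good S t); last by left; right.
  have [cvt|] := pselect (omega 0 t -> forall x : site d,
      (fun n : nat => ((n%:R)^-1)%:E * passage_time R omega S 0%R (x *+ n)%R t)%E
        @ \oo --> (mu (to_real R x))%:E); last by left; left.
  have [N _ hN] := cvt w0 x _ (nbhs_open_ereal_lt (f := fun=> c) mu_lt).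
  (* [N.+1] forces [n > 0], so that the inequality can be multiplied by [n]. *)
  right; exists N.+1 => // n /= Nn; split => //=.
  have n0 : 0 < n%:R :> R by rewrite ltr0n (leq_trans _ Nn).
  by have := hN n (ltnW Nn); rewrite /= lte_pdivrMl// muleC -EFinM.
move=> /(measure_negligible mC.1) /(eq_trans (esym mC.2)) /eqP.
rewrite eqe big_seq1 /path_weight eqxx /=.
case: ifPn => [_|/negP[]]; last by apply/forallP => -[].
by rewrite expr0 invr1 mulr1 gt_eqF.
Qed.

(** * Extension from integer to real vectors *)

Lemma le_l1norm (R : realType) d (mu : 'rV[R]_d -> R) : is_norm mu ->
  exists2 C, 0 <= C & forall v, mu v <= C * l1norm v.
Proof.
move=> [mu0 [_ [muZ muD]]]; exists (\sum_i mu (delta_mx 0 i)); first exact: sumr_ge0.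
move=> v; rewrite {1}[v]row_sum_delta.
apply: (@le_trans _ _ (\sum_j mu (v 0 j *: delta_mx 0 j))).
  elim/big_ind2 : _ => //; last by move=> a b c e ab ce; rewrite (le_trans (muD _ _))// lerD.
  by have := muZ 0 0; rewrite scale0r normr0 mul0r => ->.
rewrite mulr_suml; apply: ler_sum => j _; rewrite muZ mulrC ler_wpM2l//.
by rewrite /l1norm (bigD1 j)//= lerDl sumr_ge0.
Qed.

Lemma l1normD (R : realType) d (v w : 'rV[R]_d) : l1norm (v + w) <= l1norm v + l1norm w.
Proof. by rewrite -big_split; apply: ler_sum => i _; rewrite mxE ler_normD. Qed.

Lemma l1normZ (R : realType) d (a : R) (v : 'rV[R]_d) : l1norm (a *: v) = `|a| * l1norm v.
Proof. by rewrite /l1norm mulr_sumr; apply: eq_bigr => i _; rewrite mxE normrM. Qed.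

(** Homogeneity gives the bound at [floor(n x) / n], which is within [d / n] of [x] in [l1]. Passing
    to [x] costs [c d / n] on the left and [C d / n] for [mu]. *)
Lemma norm_ge_of_int (R : realType) d (mu : 'rV[R]_d -> R) (c : R) : is_norm mu -> 0 <= c ->
  (forall x : site d, c * l1norm (to_real R x) <= mu (to_real R x)) ->
  forall x, c * l1norm x <= mu x.
Proof.
move=> nmu c0 hint x; have [C C0 muC] := le_l1norm nmu.
have [mu0 [_ [muZ muD]]] := nmu.
apply/ler_addgt0Pr => e e0.
pose D := (c + C) * d%:R; have D0 : 0 <= D by rewrite mulr_ge0// addr_ge0.
pose n := (Num.trunc (D / e)).+1; have n0 : 0 < n%:R :> R by rewrite ltr0n.
have Dn : D / n%:R <= e.
  by rewrite ler_pdivrMr// mulrC -ler_pdivrMr// ltW// truncnS_gt.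
pose z : site d := \row_i Num.floor (n%:R * x 0 i).
pose u := n%:R^-1 *: to_real R z.
have xu : l1norm (x - u) <= d%:R / n%:R.
  rewrite -[d in d%:R]card_ord mulr_natl -sumr_const; apply: ler_sum => i _.
  rewrite !mxE; have /andP[f1 f2] := floor_itv (n%:R * x 0 i).
  move: (Num.floor _) f1 f2 => f f1 f2.
  rewrite -[x 0 i](mulKf (lt0r_neq0 n0)) -mulrBr normrM ger0_norm ?invr_ge0 ?(ltW n0)//.
  rewrite ler_piMr ?invr_ge0 ?(ltW n0)// ger0_norm ?subr_ge0//.
  by rewrite lerBlDl; move: f2; rewrite intrD => /ltW; rewrite addrC.
have ux : l1norm (u - x) <= d%:R / n%:R.
  by rewrite -opprB -scaleN1r l1normZ normrN1 mul1r.
have hu : c * l1norm u <= mu u.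
  rewrite /u l1normZ muZ mulrCA ler_wpM2l//.
have h1 : l1norm x <= l1norm u + d%:R / n%:R.
  by rewrite -{1}[x](subrK u) addrC (le_trans (l1normD _ _))// lerD.
have h2 : mu u <= mu x + C * (d%:R / n%:R).
  rewrite -{1}[u](subrK x) addrC (le_trans (muD _ _))// lerD// (le_trans (muC _))//.
  by rewrite ler_wpM2l.
apply: (@le_trans _ _ (c * (l1norm u + d%:R / n%:R))); first by rewrite ler_wpM2l.
apply: (@le_trans _ _ (mu x + D / n%:R)); last by rewrite lerD.
by rewrite /D -mulrA mulrDl mulrDr; lra.
Qed.

Lemma time_constant_ge (R : realType) d (r eta G : R) J (mu : 'rV[R]_d -> R) :
  is_time_constant r mu -> (0 < d)%N -> 0 < r -> r <= 1 -> 0 < eta -> eta <= 1 ->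
  0 < G -> r * (4 / eta ^+ 2) <= G ->
  G <= \sum_(j < J) (1 + eta ^+ 2)^-1 ^+ j * walk_prob R j (0 : site d) ->
  forall x, (4 * eta)^-1 * l1norm x <= mu x.
Proof.
move=> tc d0 r0 r1 e0 e1 G0 rG GJ; apply: norm_ge_of_int; first by case: tc.
  by rewrite invr_ge0 mulr_ge0// ltW.
by move=> x; rewrite mulrC (time_constant_ge_int x tc d0 r0 r1 e0 e1 G0 rG GJ).
Qed.

(** * Choice of the tilt in each dimension *)

(** With [l = |ln r|], take [eta^2 = C r / l]. The value of [C] makes [4 r / eta^2 = 4 l / C] equal
    to [(e^-2 / 4) (l / 2)], and [ln(1/eta^2) = l + ln l - ln C >= l / 2]. *)
Lemma time_constant_ge_planar (R : realType) : exists A1 : R, 0 < A1 /\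
  exists r0 : R, 0 < r0 /\ forall r, 0 < r -> r <= r0 -> r <= 1 ->
  forall mu : 'rV[R]_2 -> R, is_time_constant r mu ->
  forall x, A1 * delta 2 r * l1norm x <= mu x.
Proof.
pose C : R := 32 * expR 2.
have C1 : 1 <= C by have := expR_ge1Dx (2 : R); rewrite /C; lra.
have C0 : 0 < C by apply: lt_le_trans C1.
exists (4 * Num.sqrt C)^-1; split; first by rewrite invr_gt0 mulr_gt0// sqrtr_gt0.
(* Ensures [l / 2 >= C > ln C], and also [u <= 1]. *)
exists (expR (- (2 * C))); split; first exact: expR_gt0.
move=> r r0 rle r1 mu tc x.
pose l := - ln r.
have lC : 2 * C <= l.
  by rewrite /l lerNr -[leRHS]expRK ler_ln ?posrE ?expR_gt0.
have l0 : 0 < l by apply: lt_le_trans lC; rewrite mulr_gt0.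
have lnE : `|ln r| = l by rewrite ler0_norm// ln_le0.
pose u := C * r / l; have u0 : 0 < u by rewrite divr_gt0// mulr_gt0.
have u1 : u <= 1.
  rewrite ler_pdivrMr// mul1r (le_trans _ lC)// mulrC.
  by rewrite ler_wpM2r ?(ltW C0)// (le_trans r1)// ler1n.
have eta2 : Num.sqrt u ^+ 2 = u by rewrite sqr_sqrtr// ltW.
have eta0 : 0 < Num.sqrt u by rewrite sqrtr_gt0.
have eta1 : Num.sqrt u <= 1 by rewrite -sqrtr1 ler_wsqrtr.
have [J GJ] := green_lower_planar u0.
set G := expR (- 2) / 4 * ln u^-1 in GJ.
have lnu : l / 2 <= ln u^-1.
  have -> : u^-1 = l / C * r^-1 by rewrite /u invf_div invfM mulrA.
  rewrite lnM ?posrE ?invr_gt0 ?divr_gt0// lnV ?posrE// -/l ln_div ?posrE//.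
  have : 0 <= ln l by apply: ln_ge0; lra.
  have : ln C < C by apply: ln_sublinear.
  by lra.
have G0 : 0 < G.
  rewrite mulr_gt0 ?divr_gt0 ?expR_gt0// (lt_le_trans _ lnu)// divr_gt0//.
have rG : r * (4 / Num.sqrt u ^+ 2) <= G.
  rewrite eta2; have -> : r * (4 / u) = expR (- 2) / 4 * (l / 2).
    rewrite expRN /u /C; field.
    by rewrite !gt_eqF ?expR_gt0.
  by rewrite ler_wpM2l// divr_ge0// expR_ge0.
have := time_constant_ge tc isT r0 r1 eta0 eta1 G0 rG _ x; rewrite eta2 => /(_ _ GJ).
congr (_ * _ <= _); rewrite /delta /= lnE !invfM -mulrA; congr (_ * _).
rewrite /u -mulrA sqrtrM ?(ltW C0)// invfM; congr (_ * _).
by rewrite -sqrtrV ?divr_ge0 ?(ltW r0) ?(ltW l0)// invf_div.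
Qed.

(** The term at time 0 gives [G = 1], and [eta = 2 sqrt r] makes [4 r / eta^2] equal to 1. The
    condition [eta <= 1] is [r <= 1/4], and [1/(4 eta)] yields the constant [1/8]. *)
Lemma time_constant_ge_high (R : realType) d : (2 < d)%N -> exists A1 : R, 0 < A1 /\
  exists r0 : R, 0 < r0 /\ forall r, 0 < r -> r <= r0 -> r <= 1 ->
  forall mu : 'rV[R]_d -> R, is_time_constant r mu ->
  forall x, A1 * delta d r * l1norm x <= mu x.
Proof.
move=> d2; exists 8^-1; split; first by rewrite invr_gt0.
exists 4^-1; split; first by rewrite invr_gt0.
move=> r r0 rle r1 mu tc x.
have s0 : 0 < Num.sqrt r by rewrite sqrtr_gt0.
have s2 : Num.sqrt r ^+ 2 = r by rewrite sqr_sqrtr// ltW.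
have eta0 : 0 < 2 * Num.sqrt r by rewrite mulr_gt0.
have eta1 : 2 * Num.sqrt r <= 1.
  rewrite -(@ler_pXn2r _ 2) ?nnegrE ?(ltW eta0)// expr1n exprMn s2.
  by rewrite expr2; lra.
have rG : r * (4 / (2 * Num.sqrt r) ^+ 2) <= 1.
  rewrite exprMn s2 le_eqVlt; apply/orP; left; apply/eqP; field.
  by rewrite gt_eqF.
have GJ : 1 <= \sum_(j < 1) (1 + (2 * Num.sqrt r) ^+ 2)^-1 ^+ j *
    walk_prob R j (0 : site d).
  by rewrite big_ord1 /= eqxx mulr1.
have := time_constant_ge tc (ltnW (ltnW d2)) r0 r1 eta0 eta1 ltr01 rG GJ x.
congr (_ * _ <= _); rewrite /delta gtn_eqF// mulrA invfM; congr (_^-1 * _).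
by rewrite -natrM.
Qed.

(** For [d = 2], [r <= 1/e] gives [|ln r| >= 1]. This common lower bound lets the divergence be
    proved for all dimensions at once. *)
Lemma sqrt_inv_le_delta (R : realType) d (r : R) : 0 < r -> r <= expR (- 1) ->
  (Num.sqrt r)^-1 <= delta d r.
Proof.
move=> r0 re; rewrite /delta; case: ifP => // _.
rewrite -sqrtrV ?(ltW r0)// ler_wsqrtr// -[leLHS]mul1r ler_wpM2r ?invr_ge0 ?(ltW r0)//.
have : ln r <= - 1 by rewrite -[leRHS]expRK ler_ln ?posrE ?expR_gt0.
by move=> lr; rewrite ler0_norm; lra.
Qed.

Lemma l1norm_gt0 (R : realType) d (x : 'rV[R]_d) : x != 0 -> 0 < l1norm x.
Proof.
move=> x0; rewrite lt0r sumr_ge0// andbT; apply: contra x0 => /eqP.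
move/psumr_eq0P => h; apply/eqP/rowP => i; rewrite mxE.
by apply/eqP/normr0P; rewrite h.
Qed.

Theorem theorem1p1 (R : realType) (d : nat) : (2 <= d)%N ->
  (exists A1 : R, 0 < A1 /\
    exists r0 : R, 0 < r0 /\
      forall r : R, 0 < r -> r <= r0 -> r <= 1 ->
      forall mu : 'rV[R]_d -> R, is_time_constant r mu ->
      forall x : 'rV[R]_d, A1 * delta d r * l1norm x <= mu x) /\
  (forall mu : R -> 'rV[R]_d -> R,
     (forall r : R, 0 < r -> r <= 1 -> is_time_constant r (mu r)) ->
     forall x : 'rV[R]_d, x != 0 ->
       (fun r => mu r x) @ 0^'+ --> +oo).
Proof.
move=> d2.
have bound : exists A1 : R, 0 < A1 /\
    exists r0 : R, 0 < r0 /\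
      forall r : R, 0 < r -> r <= r0 -> r <= 1 ->
      forall mu : 'rV[R]_d -> R, is_time_constant r mu ->
      forall x : 'rV[R]_d, A1 * delta d r * l1norm x <= mu x.
  move: d2; rewrite leq_eqVlt => /orP[/eqP <-|]; first exact: time_constant_ge_planar.
  exact: time_constant_ge_high.
split=> // mu tc x x0; have [A1 [A0 [r0 [r00 hA]]]] := bound.
have L0 := l1norm_gt0 x0.
apply/cvgryPge => B.
(* Chosen so that [A1 b^-1] times the [l1] norm of [x] is [|B| + 1]; then [r <= b^2] gives
   [1 / sqrt r >= 1/b]. *)
pose b := A1 * l1norm x / (`|B| + 1).
have B1 : 0 < `|B| + 1 by rewrite ltr_wpDl.
have b0 : 0 < b by rewrite divr_gt0// mulr_gt0.
near=> r.
have rpos : 0 < r by near: r; exact: nbhs_right_gt.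
have r1 : r <= 1 by near: r; exact: nbhs_right_le.
have rr0 : r <= r0 by near: r; exact: nbhs_right_le.
have re : r <= expR (- 1) by near: r; apply: nbhs_right_le; exact: expR_gt0.
have rb : r <= b ^+ 2 by near: r; apply: nbhs_right_le; rewrite exprn_gt0.
apply: le_trans (hA r rpos rr0 r1 _ (tc r rpos r1) x).
apply: (@le_trans _ _ (A1 * b^-1 * l1norm x)).
  rewrite /b invf_div mulrAC mulrC divfK; last by rewrite mulf_neq0 ?gt_eqF.
  by rewrite (le_trans (ler_norm _))// lerDl.
rewrite ler_wpM2r ?(ltW L0)// ler_wpM2l ?(ltW A0)//.
apply: le_trans (sqrt_inv_le_delta d rpos re).
rewrite lef_pV2 ?posrE ?sqrtr_gt0// -[leRHS]gtr0_norm// -sqrtr_sqr.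
by rewrite ler_wsqrtr.
Unshelve. all: by end_near.
Qed.
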